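(* Let $\Gamma \curvearrowright T$ be an action of a group $\Gamma$ by automorphisms on a simplicial tree $T$ such that all vertex stabilizers are amenable. Let $s$ be an oriented geodesic segment in $T$, let $x$ be a vertex of $T$, and let $f_{s,x}\colon\Gamma\to\mathbb{R}$ be the corresponding median quasimorphism of $\Gamma$. Then, for every $n\geq 1$ and every $\zeta\in H^n_b(\Gamma;\mathbb{R})$, the cup product $[\delta^1\widehat{f_{s,x}}]\cup\zeta$ is trivial in $H^{n+2}_b(\Gamma;\mathbb{R})$.
   Context: Bounded cohomology: for a discrete group $\Gamma$, $C^n_b(\Gamma;\mathbb{R}):=\ell^\infty(\Gamma^{n+1},\mathbb{R})^\Gamma$ (bounded functions invariant under diagonal left translation) with the simplicial coboundary $\delta^n\kappa(\gamma_0,\dots,\gamma_{n+1})=\sum_{j}(-1)^j\kappa(\gamma_0,\dots,\hat\gamma_j,\dots,\gamma_{n+1})$; $H^*_b(\Gamma;\mathbb{R})$ is its cohomology. The cup product is induced by $(f\cup g)(\gamma_0,\dots,\gamma_{p+q})=f(\gamma_0,\dots,\gamma_p)\cdot g(\gamma_p,\dots,\gamma_{p+q})$. An oriented geodesic segment in $T$ is a finite oriented geodesic edge path (of length $l\ge1$). $\Gamma$ acts on oriented segments, and the elements of the orbit $\Gamma s$ are called translates of $s$. For vertices $x,y$, $[x,y]$ denotes the oriented geodesic from $x$ to $y$. Define $f_s(x,y)$ to be the number of translates of $s$ occurring as (oriented) subsegments of $[x,y]$ minus the number of translates of $s$ occurring as (oriented) subsegments of $[y,x]$. The median quasimorphism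 of $\Gamma$ with base vertex $x$ is $f_{s,x}(\gamma):=f_s(x,\gamma\cdot x)$. It is a quasimorphism, i.e. $\sup_{\gamma,\lambda}|f_{s,x}(\gamma)+f_{s,x}(\lambda)-f_{s,x}(\gamma\lambda)|<\infty$. For a quasimorphism $f\colon\Gamma\to\mathbb{R}$, $\widehat f(\gamma_0,\gamma_1):=f(\gamma_0^{-1}\gamma_1)$; then $\delta^1\widehat f$ is a bounded cocycle defining $[\delta^1\widehat f]\in H^2_b(\Gamma;\mathbb{R})$. *)

(* Defs.v *)
From HB Require Import structures.
From mathcomp Require Import all_boot all_order all_algebra finmap.
From mathcomp Require Import all_classical all_reals zify lra.

Set Implicit Arguments.
Unset Strict Implicit.
Unset Printing Implicit Defensive.

Import Order.TTheory GRing.Theory Num.Theory.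

Local Open Scope classical_set_scope.
Local Open Scope ring_scope.

Definition linf (R : realType) (T : Type) (f : T -> R) : Prop :=
  exists M : R, forall t, `|f t| <= M.

Section LinfTheory.
Variables (R : realType) (T : Type).
Implicit Types f g : T -> R.

Lemma linf_cst (c : R) : linf (fun _ : T => c).
Proof. by exists `|c|. Qed.

Lemma linfD f g : linf f -> linf g -> linf (fun t => f t + g t).
Proof.
by move=> [M fM] [N gN]; exists (M + N) => t; rewrite (le_trans (ler_normD _ _)) ?lerD.
Qed.

Lemma linfM f g : linf f -> linf g -> linf (fun t => f t * g t).
Proof.
by move=> [M fM] [N gN]; exists (M * N) => t; rewrite normrM ler_pM.
Qed.

Lemma linf_sum (I : Type) (r : seq I) (F : I -> T -> R) :
  (forall i, linf (F i)) -> linf (fun t => \sum_(i <- r) F i t).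
Proof.
move=> Fb; elim: r => [|i r IH].
  by under eq_fun do rewrite big_nil; exact: linf_cst.
by under eq_fun do rewrite big_cons; exact: linfD.
Qed.

Lemma linf_comp (U : Type) (h : U -> T) f : linf f -> linf (fun u => f (h u)).
Proof. by move=> [M fM]; exists M => u. Qed.

End LinfTheory.

(* Amenability of a discrete group: a left-invariant mean on bounded functions;
   the values of m on unbounded functions are irrelevant. *)
Definition amenable (R : realType) (G : groupType) : Prop :=
  exists m : (G -> R) -> R,
    [/\ forall (a : R) (f g : G -> R), linf f -> linf g ->
          m (fun x => a * f x + g x) = a * m f + m g,
        forall f : G -> R, linf f -> (forall x, 0 <= f x) -> 0 <= m f,
        m (fun _ => 1) = 1
      & forall (f : G -> R) (h : G), linf f -> m (fun x => f (h * x)%g) = m f].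

Section Cochains.
Variables (R : realType) (G : groupType).

Definition cochain (n : nat) := ('I_n.+1 -> G) -> R.

HB.instance Definition _ n := GRing.Zmodule.copy (cochain n) (('I_n.+1 -> G) -> R).

Definition delta n (k : cochain n) : cochain n.+1 :=
  fun c => \sum_(j < n.+2) (-1) ^+ j * k (fun i => c (lift j i)).

Definition cup p q (f : cochain p) (g : cochain q) : cochain (p + q) :=
  fun c => f (fun i => c (widen_ord (leq_addr q p : p.+1 <= (p + q).+1)%N i))
         * g (fun i => c (cast_ord (addnS p q) (rshift p i))).

(* Evaluation along sequences nat -> G, which avoids casts between ordinals. *)
Definition eval n (k : cochain n) (c : nat -> G) : R := k (fun i => c i).

Lemma eval_ext n (k : cochain n) (c c' : nat -> G) :
  (forall i, (i <= n)%N -> c i = c' i) -> eval k c = eval k c'.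
Proof. by move=> cc'; congr k; apply/funext => i; apply: cc'; rewrite -ltnS. Qed.

Lemma cochain_eqP n (k k' : cochain n) :
  (forall c, eval k c = eval k' c) -> k = k'.
Proof.
move=> kk'; apply/funext => c.
have -> : c = (fun i : 'I_n.+1 => c (inord i)) by apply/funext => i; rewrite inord_val.
exact: (kk' (fun i => c (inord i))).
Qed.

Lemma eval_delta n (k : cochain n) c :
  eval (delta k) c = \sum_(j < n.+2) (-1) ^+ j * eval k (c \o bump j).
Proof. by []. Qed.

Lemma eval_cup p q (f : cochain p) (g : cochain q) c :
  eval (cup f g) c = eval f c * eval g (fun i => c (p + i)%N).
Proof. by []. Qed.

Lemma deltaK n (k : cochain n) : delta (delta k) = 0.
Proof.
apply: cochain_eqP => c; rewrite eval_delta.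
under eq_bigr do rewrite eval_delta big_distrr /=.
set F := fun (j i : nat) => (-1) ^+ j * ((-1) ^+ i * eval k ((c \o bump j) \o bump i)).
rewrite -[LHS]/(\sum_(j < n.+3) \sum_(i < n.+2) F j i).
have -> : \sum_(j < n.+3) \sum_(i < n.+2) F j i =
    \sum_(j < n.+3) \sum_(i < n.+2 | (i < j)%N) F j i +
    \sum_(j < n.+3) \sum_(i < n.+2 | ~~ (i < j)%N) F j i.
  by rewrite -big_split; apply: eq_bigr => j _; rewrite (bigID (fun i : 'I__ => (i < j)%N)).
have -> : \sum_(j < n.+3) \sum_(i < n.+2 | ~~ (i < j)%N) F j i =
    \sum_(i < n.+2) \sum_(j < n.+2 | (j <= i)%N) F j i.
  under eq_bigr do rewrite big_mkcond.
  rewrite exchange_big; apply: eq_bigr => i _ /=.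
  rewrite big_ord_recr /= ltn_ord /= addr0 [RHS]big_mkcond.
  by apply: eq_bigr => j _; rewrite -leqNgt.
rewrite big_ord_recl /= big_pred0 // add0r -big_split big1 // => i _ /=.
rewrite -big_split big1 //= => j; rewrite ltnS => ji.
rewrite /F -[bump 0 i]/(i.+1) !mulrA -!exprD addSn exprS mulN1r addnC mulNr.
suff -> : eval k ((c \o bump i.+1) \o bump j) = eval k ((c \o bump j) \o bump i).
  by rewrite addNr.
apply: eval_ext => m _ /=; congr c; rewrite /bump.
by case: (leqP j m) => jm; case: (leqP i m) => im /=;
   rewrite ?add0n ?add1n ?ltnS ?leqW ?jm ?im //;
   case: leqP => //; move: ji jm im; lia.
Qed.

Lemma leibniz p q (f : cochain p) (g : cochain q) c :
  eval (delta (cup f g)) c =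
  eval (delta f) c * eval g (fun i => c (p.+1 + i)%N) +
  (-1) ^+ p * (eval f c * eval (delta g) (fun i => c (p + i)%N)).
Proof.
pose F j := (-1) ^+ j * (eval f (c \o bump j) * eval g (fun i => c (bump j (p + i)))) : R.
have -> : eval (delta (cup f g)) c =
    \sum_(j < p.+1) F j + \sum_(i < q.+1) F (p.+1 + i)%N.
  have E : (p.+1 + q.+1 = (p + q).+2)%N by rewrite addnS addSn.
  rewrite -[LHS]/(\sum_(j < (p + q).+2) F j) -E.
  by rewrite big_split_ord.
rewrite !eval_delta [X in X * _]big_ord_recr [X in eval f c * X]big_ord_recl /=.
rewrite mulrDl big_distrl /= expr0 mul1r [eval f c * _]mulrDr mulrDr.
have Hlow (j : 'I_p.+1) : F j =
    (-1) ^+ j * eval f (c \o bump j) * eval g (fun i => c (p.+1 + i)%N).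
  rewrite /F mulrA; congr (_ * _); apply: eval_ext => i _; congr c.
  by rewrite /bump (leq_trans _ (leq_addr i p)) // -ltnS.
have Hhigh (i : 'I_q.+1) : F (p.+1 + i)%N = (-1) ^+ p *
    (eval f c * ((-1) ^+ (bump 0 i) * eval g ((fun i => c (p + i)%N) \o bump (bump 0 i)))).
  rewrite /F -[bump 0 i]/(i.+1) addSnnS exprD -!mulrA; congr (_ * _).
  rewrite mulrCA; congr (_ * (_ * _)).
    apply: eval_ext => k kp /=; congr c; rewrite /bump.
    by case: leqP => //; lia.
  apply: eval_ext => k _ /=; congr c; rewrite /bump.
  by case: leqP; case: leqP; lia.
rewrite (eq_bigr _ (fun j _ => Hlow j)) (eq_bigr _ (fun j _ => Hhigh j)).
rewrite -addrA; congr (_ + _); rewrite addrA -[LHS]add0r -!mulr_sumr; congr (_ + _).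
have -> : eval f (c \o bump p.+1) = eval f c.
  by apply: eval_ext => k kp /=; congr c; rewrite /bump; case: leqP => //; lia.
have -> : eval g ((fun i => c (p + i)%N) \o bump 0) = eval g (fun i => c (p.+1 + i)%N).
  by apply: eval_ext => k _ /=; congr c; rewrite /bump; lia.
by rewrite exprS mulN1r -mulrA mulNr addNr.
Qed.

Definition bounded_invariant n : {pred cochain n} :=
  fun k => `[< linf k /\ forall (g : G) c, k (fun i => g * c i)%g = k c >].

Arguments bounded_invariant : clear implicits.

Lemma bounded_invariantP n (k : cochain n) :
  reflect (linf k /\ forall (g : G) c, k (fun i => g * c i)%g = k c)
          (k \in bounded_invariant n).
Proof. exact: asboolP. Qed.

Lemma bounded_invariant_zmod n : zmod_closed (bounded_invariant n).
Proof.
split; first by apply/bounded_invariantP; split=> //; exact: linf_cst.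
move=> f g /bounded_invariantP[fb fi] /bounded_invariantP[[M gM] gi].
apply/bounded_invariantP; split=> [|h c]; last by congr (_ - _).
by apply: linfD => //; exists M => c; rewrite normrN.
Qed.

HB.instance Definition _ n :=
  GRing.isZmodClosed.Build (cochain n) (bounded_invariant n) (bounded_invariant_zmod n).

(* C^n_b(G; R): bounded cochains invariant under diagonal left translation. *)
Record bcochain n := BCochain {
  bcochain_val :> cochain n;
  _ : bcochain_val \in bounded_invariant n
}.

HB.instance Definition _ n := [isSub of bcochain n for @bcochain_val n].
HB.instance Definition _ n := [Choice of bcochain n by <:].
HB.instance Definition _ n := [SubChoice_isSubZmodule of bcochain n by <:].

Lemma delta_bounded_invariant n (k : bcochain n) : delta k \in bounded_invariant n.+1.
Proof.
have /bounded_invariantP[kb ki] := valP k.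
apply/bounded_invariantP; split=> [|g c].
  apply: linf_sum => j; apply: linfM; first exact: linf_cst.
  exact: (linf_comp (fun c i => c (lift j i))).
by apply: eq_bigr => j _; rewrite (ki g (fun i => c (lift j i))).
Qed.

Definition bdelta n (k : bcochain n) : bcochain n.+1 :=
  BCochain (delta_bounded_invariant k).

Lemma bdelta_is_additive n : zmod_morphism (@bdelta n).
Proof.
move=> f g; apply/val_inj/funext => c /=.
rewrite /delta -[RHS]sumrB; apply: eq_bigr => j _.
by rewrite -mulrBr.
Qed.

HB.instance Definition _ n :=
  GRing.isZmodMorphism.Build (bcochain n) (bcochain n.+1) (@bdelta n) (@bdelta_is_additive n).

Definition is_cocycle n : {pred bcochain n} := fun k => bdelta k == 0.

Arguments is_cocycle : clear implicits.

Lemma is_cocycle_zmod n : zmod_closed (is_cocycle n).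
Proof.
split=> [|f g]; rewrite -!topredE /= /is_cocycle ?raddf0 // => /eqP f0 /eqP g0.
by rewrite raddfB /= f0 g0 subrr.
Qed.

HB.instance Definition _ n :=
  GRing.isZmodClosed.Build (bcochain n) (is_cocycle n) (is_cocycle_zmod n).

Record cocycle n := Cocycle {
  cocycle_val :> bcochain n;
  _ : cocycle_val \in is_cocycle n
}.

HB.instance Definition _ n := [isSub of cocycle n for @cocycle_val n].
HB.instance Definition _ n := [Choice of cocycle n by <:].
HB.instance Definition _ n := [SubChoice_isSubZmodule of cocycle n by <:].

Definition is_coboundary n : {pred cocycle n} :=
  match n with
  | 0 => fun z => z == 0
  | m.+1 => fun z => `[< exists b : bcochain m, cocycle_val z = bdelta b >]
  end.

Arguments is_coboundary : clear implicits.

Lemma is_coboundary_zmod n : zmod_closed (is_coboundary n).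
Proof.
case: n => [|n]; split=> [|x y]; rewrite -!topredE //=.
- by move=> /eqP-> /eqP->; rewrite subrr.
- by apply/asboolP; exists 0; rewrite raddf0.
- move=> /asboolP[b xb] /asboolP[b' yb]; apply/asboolP.
  by exists (b - b'); rewrite raddfB /= -xb -yb.
Qed.

HB.instance Definition _ n :=
  GRing.isZmodClosed.Build (cocycle n) (is_coboundary n) (is_coboundary_zmod n).

(* H^n_b(G; R), with its additive structure only. *)
Definition Hb n : zmodType := Quotient.quot (is_coboundary n).

Definition Hb_class n (z : cocycle n) : Hb n := (\pi_(Quotient.quot (is_coboundary n)) z)%qT.

Lemma Hb_class_eq n (z z' : cocycle n) :
  (Hb_class z == Hb_class z') = (z - z' \in is_coboundary n).
Proof. by rewrite Quotient.idealrBE. Qed.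

Lemma Hb_class_eq0 n (z : cocycle n) : (Hb_class z == 0) = (z \in is_coboundary n).
Proof. by rewrite -[z in RHS]subr0 -Hb_class_eq [Hb_class 0]raddf0. Qed.

Lemma cup_bounded_invariant p q (f : bcochain p) (g : bcochain q) :
  cup f g \in bounded_invariant (p + q).
Proof.
have /bounded_invariantP[fb fi] := valP f; have /bounded_invariantP[gb gi] := valP g.
apply/bounded_invariantP; split=> [|h c]; last by rewrite /cup -[in RHS](fi h) -[in RHS](gi h).
apply: linfM; first exact: (linf_comp (fun c i => c (widen_ord _ i))).
exact: (linf_comp (fun c i => c (cast_ord _ (rshift p i)))).
Qed.

Definition bcup p q (f : bcochain p) (g : bcochain q) : bcochain (p + q) :=
  BCochain (cup_bounded_invariant f g).

Lemma cocycle0 n (z : cocycle n) : bdelta z = 0.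
Proof. exact/eqP/(valP z). Qed.

Lemma eval_cocycle n (z : cocycle n) c : eval (delta z) c = 0.
Proof. exact: (congr1 (fun b : bcochain n.+1 => eval b c) (cocycle0 z)). Qed.

Lemma cup_cocycle p q (f : cocycle p) (g : cocycle q) :
  bcup f g \in is_cocycle (p + q).
Proof.
apply/eqP/val_inj/cochain_eqP => c /=.
by rewrite leibniz !eval_cocycle mul0r !mulr0 addr0.
Qed.

Definition zcup p q (f : cocycle p) (g : cocycle q) : cocycle (p + q) :=
  Cocycle (cup_cocycle f g).

Lemma is_coboundaryI m n (E : m.+1 = n) (b : bcochain m) (z : cocycle n) :
  (forall c, eval z c = eval (delta b) c) -> z \in is_coboundary n.
Proof.
case: n / E z => z zb; apply/asboolP; exists b.
exact/val_inj/cochain_eqP.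
Qed.

Lemma zcupBl p q (f f' : cocycle p) (g : cocycle q) :
  zcup (f - f') g = zcup f g - zcup f' g.
Proof. by apply/val_inj/val_inj/funext => c; rewrite /= /cup /= mulrBl. Qed.

Lemma zcupBr p q (f : cocycle p) (g g' : cocycle q) :
  zcup f (g - g') = zcup f g - zcup f g'.
Proof. by apply/val_inj/val_inj/funext => c; rewrite /= /cup /= mulrBr. Qed.

Lemma zcup_coboundaryl p q (f : cocycle p) (g : cocycle q) :
  f \in is_coboundary p -> zcup f g \in is_coboundary (p + q).
Proof.
case: p f => [|p] f.
  by move/eqP->; rewrite -(subrr 0) zcupBl subrr rpred0.
move/asboolP=> [b fb]; apply: (@is_coboundaryI (p + q) _ erefl (bcup b g)) => c.
by rewrite leibniz eval_cocycle !mulr0 addr0 -[LHS]/(eval (cup f g) c) eval_cup fb.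
Qed.

Lemma zcup_coboundaryr p q (f : cocycle p) (g : cocycle q) :
  g \in is_coboundary q -> zcup f g \in is_coboundary (p + q).
Proof.
case: q g => [|q] g.
  by move/eqP->; rewrite -(subrr 0) zcupBr subrr rpred0.
move/asboolP=> [b gb]; pose w : bcochain (p + q) := bcup f b.
have wE c : eval (delta w) c = (-1) ^+ p * eval (zcup f g) c.
  by rewrite leibniz eval_cocycle mul0r add0r -[eval (zcup f g) c]/(eval (cup f g) c) eval_cup gb.
have E : (p + q).+1 = (p + q.+1)%N by rewrite addnS.
pose w' : bcochain (p + q) := if odd p then - w else w.
have wN c : eval (delta w') c = (-1) ^+ p * eval (delta w) c.
  rewrite /w' -signr_odd; case: (odd p); last by rewrite mul1r.
  rewrite mulN1r; exact: (congr1 (fun b : bcochain _ => eval b c) (raddfN (@bdelta _) w)).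
apply: (@is_coboundaryI _ _ E w') => c.
by rewrite wN wE mulrA -expr2 sqrr_sign mul1r.
Qed.

(* Well defined on classes, see Hb_cup_class. *)
Definition Hb_cup p q (a : Hb p) (b : Hb q) : Hb (p + q) :=
  Hb_class (zcup (repr a) (repr b)).

Lemma Hb_cup_class p q (f : cocycle p) (g : cocycle q) :
  Hb_cup (Hb_class f) (Hb_class g) = Hb_class (zcup f g).
Proof.
have reprP n (z : cocycle n) : repr (Hb_class z) - z \in is_coboundary n.
  by rewrite -Hb_class_eq [Hb_class (repr _)]reprK.
apply/eqP; rewrite Hb_class_eq.
rewrite -[X in X - _](subrK (zcup f (repr (Hb_class g)))) -addrA -zcupBl -zcupBr.
by apply: rpredD; [apply: zcup_coboundaryl | apply: zcup_coboundaryr]; exact: reprP.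
Qed.

Record quasimorphism := Quasimorphism {
  qm_fun :> G -> R;
  qmP : exists D : R, forall g h, `|qm_fun g + qm_fun h - qm_fun (g * h)%g| <= D
}.

Definition hat (f : G -> R) : cochain 1 :=
  fun c => f ((c ord0)^-1 * c (lift ord0 ord0))%g.

Lemma delta_hat (f : G -> R) (c : 'I_3 -> G) (g := fun i j => ((c i)^-1 * c j)%g) :
  delta (hat f) c = f (g (inord 1) (inord 2)) + f (g (inord 0) (inord 1))
                    - f (g (inord 0) (inord 2)).
Proof.
rewrite /delta !big_ord_recl big_ord0 /hat /= !expr0 expr1 mul1r mulN1r.
rewrite expr2 mulrN1 opprK mul1r addr0 addrA addrAC.
by congr (f (g _ _) + f (g _ _) - f (g _ _)); apply: val_inj; rewrite /= inordK.
Qed.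

Lemma delta_hat_bounded_invariant (f : quasimorphism) :
  delta (hat f) \in bounded_invariant 2.
Proof.
apply/bounded_invariantP; split=> [|h c]; last first.
  by rewrite !delta_hat !invgM -!mulgA !mulKg.
have [D fD] := qmP f; exists D => c; rewrite delta_hat [X in X - _]addrC.
set a := c _; set b := c _; set d := c _.
have -> : (a^-1 * d = (a^-1 * b) * (b^-1 * d))%g by rewrite -mulgA mulVKg.
exact: fD.
Qed.

Lemma delta_hat_cocycle (f : quasimorphism) :
  BCochain (delta_hat_bounded_invariant f) \in is_cocycle 2.
Proof. by apply/eqP/val_inj/deltaK. Qed.

Definition qm_cocycle (f : quasimorphism) : cocycle 2 := Cocycle (delta_hat_cocycle f).

Definition qm_class (f : quasimorphism) : Hb 2 := Hb_class (qm_cocycle f).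

End Cochains.

(* The 1-skeleton of a simplicial tree; since every type carries a choiceType
   structure classically and every relation is decidable, neither choiceType
   nor the boolean adjacency is a restriction. *)
Record tree := Tree {
  vertex :> choiceType;
  adj : rel vertex;
  adj_sym : symmetric adj;
  adj_irrefl : irreflexive adj;
  adj_connected : forall x y, exists2 p, path adj x p & last x p = y;
  adj_acyclic : forall c, (2 < size c)%N -> ~ ucycle adj c
}.

Section Geodesics.
Variable T : tree.
Implicit Types (x y z : T) (p q s : seq T).

Definition is_geodesic x y s : Prop :=
  exists2 p, s = x :: p &
    [/\ path (@adj T) x p, last x p = y &
        forall q, path (@adj T) x q -> last x q = y -> (size p <= size q)%N].

(* [x, y], as the sequence of its vertices *)
Definition geod x y : seq T := xget [::] [set s | is_geodesic x y s].

Lemma geod_is_geodesic x y : is_geodesic x y (geod x y).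
Proof.
suff [s sP] : exists s, is_geodesic x y s by exact: (@xgetPex _ [::] _ (ex_intro _ s sP)).
pose P n := `[< exists q, [/\ path (@adj T) x q, last x q = y & size q = n] >].
have exP : exists n, P n.
  by have [q qp ql] := adj_connected x y; exists (size q); apply/asboolP; exists q.
case: (ex_minnP exP) => n /asboolP[p [pp pl ps]] min.
exists (x :: p), p => //; split=> // q qp ql; rewrite ps.
by apply: min; apply/asboolP; exists q.
Qed.

Definition simple_path x y s := [/\ path (@adj T) x s, last x s = y & uniq (x :: s)].

Lemma simple_path_rev x y s : simple_path x y s ->
  exists2 s', rev (x :: s) = y :: s' & simple_path y x s'.
Proof.
move=> [sp sl su]; exists (rev (belast x s)); first by rewrite lastI rev_rcons sl.
split; last first.
- by rewrite -sl -rev_rcons -lastI rev_uniq.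
- by case: s sl {sp su} => [|a s] //= _; rewrite rev_cons last_rcons.
- by rewrite -sl rev_path; under eq_path do rewrite adj_sym.
Qed.

Lemma simple_path_uniq x y p q : simple_path x y p -> simple_path x y q -> p = q.
Proof.
move=> [pp <- {y} pu] [qp ql qu].
elim: p x q pp pu qp ql qu => [|a p IH] x [|b q] //=.
- by move=> _ _ _ ql /andP[/negP[]]; rewrite -[X in X \in _]ql mem_last.
- by move=> _ /andP[xap _] _ ql; case/negP: xap; rewrite [X in X \in _]ql mem_last.
move=> /andP[xa pp] /andP[xap apu] /andP[xb qp] ql /andP[xbq bqu].
case: (eqVneq a b) => [ab|ab].
  by subst b; congr (_ :: _); apply: (IH a).
exfalso.
have hasw : has (mem (b :: q)) (a :: p).
  by apply/hasP; exists (last a p); [exact: mem_last | rewrite -ql /=; exact: mem_last].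
have pp' : path (@adj T) x (a :: p) by rewrite /= xa.
have qp' : path (@adj T) x (b :: q) by rewrite /= xb.
have apu' : uniq (a :: p) := apu; have bqu' : uniq (b :: q) := bqu.
have hp : head x (a :: p) != head x (b :: q) by [].
move: (a :: p) (b :: q) hasw hp xap xbq pp' qp' apu' bqu'.
move=> {pp qp ql xa xb ab IH apu bqu} {}p {}q.
move=> hasw hp xp xq pp qp pu qu.
case: (split_find hasw) hp xp pp pu => w P1 P2 wq nP1.
case/splitPr: wq nP1 xq qp qu => Q1 Q2 nP1 xq qp qu hp xp pp pu.
have := @adj_acyclic T (x :: P1 ++ w :: rev Q1); apply.
  rewrite /= size_cat /= size_rev addnS !ltnS.
  by case: P1 {nP1 xp pp pu} hp => [|? ?] //=; case: Q1 {xq qp qu} => //=; rewrite eqxx.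
move: pp; rewrite cat_path => /andP[ppw _].
move: qp; rewrite -cat_rcons cat_path => /andP[qpw _].
move: xp; rewrite mem_cat mem_rcons inE !negb_or -!andbA => /and3P[xw xP1 _].
move: xq; rewrite mem_cat inE !negb_or => /andP[xQ1 _].
move: pu; rewrite cat_uniq rcons_uniq => /andP[/andP[wP1 P1u] _].
move: qu; rewrite cat_uniq /= negb_or => /and3P[Q1u /andP[wQ1 _] _].
rewrite /ucycle /= -cat_rcons rcons_cat cat_path ppw last_rcons.
have -> : path (@adj T) w (rcons (rev Q1) x).
  have := rev_path (@adj T) x (rcons Q1 w); rewrite last_rcons belast_rcons rev_cons => ->.
  by under eq_path do rewrite adj_sym.
rewrite mem_cat mem_rcons inE !negb_or xw xP1 mem_rev xQ1 /=.
rewrite cat_uniq rcons_uniq wP1 P1u rev_uniq Q1u !andbT /=.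
apply/hasPn => v; rewrite mem_rev mem_rcons inE negb_or => vQ1.
rewrite (memPn wQ1) //=; apply: contra nP1 => vP1.
by apply/hasP; exists v => //=; rewrite mem_cat vQ1.
Qed.

Lemma geodP x y : exists2 s, geod x y = x :: s & simple_path x y s.
Proof.
have [s -> [sp sl smin]] := geod_is_geodesic x y; exists s => //; split=> //.
move: sl; case: (shortenP sp) => s' s'p s'u s's sl.
apply: (leq_size_uniq s'u); last by rewrite /= ltnS smin.
by move=> v; rewrite !inE => /orP[->//|/s's->]; rewrite orbT.
Qed.

Lemma geod_uniq x y : uniq (geod x y).
Proof. by have [s -> []] := geodP x y. Qed.

Lemma geodE x y s : simple_path x y s -> geod x y = x :: s.
Proof. by have [s' -> s'P] := geodP x y => sP; rewrite (simple_path_uniq s'P sP). Qed.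

Lemma geod_rev x y : geod y x = rev (geod x y).
Proof.
have [s -> sP] := geodP x y; have [s' -> s'P] := simple_path_rev sP.
exact: geodE.
Qed.

Lemma geod_split x y m A B : geod x y = A ++ m :: B ->
  geod x m = rcons A m /\ geod m y = m :: B.
Proof.
have [s -> [sp sl su]] := geodP x y.
case: A => [[<- sB]|a A [<- sAB]].
  by split; [exact: geodE | rewrite -sB; exact: geodE].
move: sp sl su; rewrite sAB -cat_rcons cat_path last_cat last_rcons -cat_cons cat_uniq.
move=> /andP[sp1 sp2] sl /and3P[u1 u12 u2]; split; apply: geodE; split=> //=.
- by rewrite last_rcons.
- rewrite u2 andbT; apply: contra u12 => mB; apply/hasP; exists m => //.
  by rewrite inE mem_rcons mem_head orbT.
Qed.

Lemma geod_cat x y m A B : geod x m = rcons A m -> geod m y = m :: B ->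
  ~~ has (mem A) B -> geod x y = A ++ m :: B.
Proof.
have [s -> [sp sl su]] := geodP x m; have [t -> [tp tl tu]] := geodP m y.
move=> sA [tB] AB; rewrite -cat_rcons -sA -tB cat_cons; apply: geodE; split.
- by rewrite cat_path sp sl.
- by rewrite last_cat sl.
- move: tu; rewrite cons_uniq => /andP[mt tu]; rewrite -cat_cons cat_uniq su tu andbT /=.
  rewrite sA; apply/hasPn => v vt; rewrite /= mem_rcons inE negb_or.
  rewrite (memPn mt) //=; apply: contra AB => vA; apply/hasP; exists v => //.
  by rewrite -tB.
Qed.

Lemma geod_left x y : x \in geod x y.
Proof. by have [s -> _] := geodP x y; rewrite mem_head. Qed.

Lemma geod_sym_mem x y m : (m \in geod y x) = (m \in geod x y).
Proof. by rewrite geod_rev mem_rev. Qed.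

Lemma geod_median x y z :
  exists m, [/\ m \in geod x y, m \in geod y z & m \in geod x z].
Proof.
have hx : has (mem (geod x z)) (geod y x).
  by apply/hasP; exists x; rewrite /= ?geod_left // geod_sym_mem geod_left.
have [m [B [A [mxz nB E]]]] : exists m B A,
    [/\ m \in geod x z, ~~ has (mem (geod x z)) B & geod y x = B ++ m :: A].
  by case: (split_find hx) => m B A mxz nB; exists m, B, A; rewrite cat_rcons.
have [C [D E2]] : exists C D, geod x z = C ++ m :: D.
  by case/splitPr: mxz => C D; exists C, D.
exists m; split=> //; first by rewrite -geod_sym_mem E mem_cat mem_head orbT.
rewrite (@geod_cat _ _ m B D) ?mem_cat ?mem_head ?orbT //.
- by case: (geod_split E).
- by case: (geod_split E2).
- apply/hasPn => v vD; apply: contra nB => vB; apply/hasP; exists v => //=.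
  by rewrite E2 mem_cat inE vD !orbT.
Qed.

End Geodesics.

(* A segment of length l is the sequence of its l + 1 vertices, with l >= 1. *)
Record segment (T : tree) := Segment {
  seg :> seq T;
  seg_gt1 : (1 < size seg)%N;
  seg_geodesic : exists x y, is_geodesic x y seg
}.

(* Inversions of edges are allowed. *)
Record tree_action (G : groupType) (T : tree) := TreeAction {
  act :> G -> T -> T;
  act1 : forall x, act 1%g x = x;
  actM : forall g h x, act (g * h)%g x = act g (act h x);
  act_adj : forall g x y, adj (act g x) (act g y) = adj x y
}.

Section Stabilizers.
Variables (G : groupType) (T : tree) (a : tree_action G T) (x : T).

Definition stab : {pred G} := fun g => a g x == x.

Lemma stab_group_closed : group_closed stab.
Proof.
split; first by rewrite -topredE /= /stab act1.
move=> g h; rewrite -!topredE /= /stab actM => /eqP gx /eqP hx.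
have -> : a h^-1%g x = x by rewrite -{1}hx -actM mulVg act1.
by rewrite gx.
Qed.

Definition stabilizer := {g : G | g \in stab}.

HB.instance Definition _ := SubChoice.on stabilizer.
HB.instance Definition _ :=
  SubChoice_isSubGroup.Build G (fun g => g \in stab) stabilizer stab_group_closed.

End Stabilizers.

Section MedianQuasimorphism.
Variables (R : realType) (G : groupType) (T : tree) (a : tree_action G T).
Implicit Types (x y z : T) (g : G) (s : segment T).

Definition translates (s : seq T) : set (seq T) := [set t | exists g, t = map (a g) s].

(* fset_set is the empty set on infinite sets, but the set below is finite by
   card_translates. Subsegments of [x, y] are contiguous factors of its vertex
   sequence. *)
Definition num_translates (s : seq T) x y : nat :=
  #|` fset_set [set t | translates s t /\ infix t (geod x y)]|.

Definition f_seg (s : seq T) x y : R :=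
  (num_translates s x y)%:R - (num_translates s y x)%:R.

Lemma act_inj g : injective (a g).
Proof. by move=> x y /(congr1 (a g^-1%g)); rewrite -!actM mulVg !act1. Qed.

Lemma geod_act g x y : geod (a g x) (a g y) = map (a g) (geod x y).
Proof.
have [s -> [sp sl su]] := geodP x y; apply: geodE; split.
- by rewrite path_map; under eq_path do rewrite /= act_adj.
- by rewrite last_map sl.
- by rewrite -map_cons map_inj_uniq //; exact: act_inj.
Qed.

(* Recursive count of the occurrences of translates of s in p *)
Fixpoint occ (s p : seq T) : nat :=
  if p is _ :: p' then (`[< translates s (take (size s) p) >] + occ s p')%N else 0%N.

Lemma translates_size s t : translates s t -> size t = size s.
Proof. by move=> [g ->]; rewrite size_map. Qed.

Lemma card_translates s p : uniq p ->
  finite_set [set t | translates s t /\ infix t p] /\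
  #|` fset_set [set t | translates s t /\ infix t p]| = occ s p.
Proof.
have sP t : translates s t -> t != [::].
  by move/translates_size; case: t => // /esym; have := seg_gt1 s; case: (seg s).
elim: p => [_|v p IH] /=.
  have -> : [set t | translates s t /\ infix t [::]] = set0.
    by apply/seteqP; split=> t //= -[/sP]; case: t.
  by rewrite fset_set0 cardfs0; split; first exact: finite_set0.
move=> /andP[vp /IH[fin <-]].
set t0 := take _ (v :: p).
have prefE t : translates s t -> prefix t (v :: p) = (t == t0).
  move=> st; rewrite prefixE (translates_size st) eq_sym //.
have [st0|nst0] := pselect (translates s t0).
  have -> : [set t | translates s t /\ infix t (v :: p)] =
            t0 |` [set t | translates s t /\ infix t p].
    apply/seteqP; split=> t; rewrite /setU /set1 /mkset infix_consl.
      by move=> [st /orP[|]]; [rewrite prefE // => /eqP; left | right].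
    by move=> [->|[st tp]]; [rewrite prefE // eqxx | rewrite tp orbT].
  split; first by rewrite finite_setU; split=> //; exact: finite_set1.
  rewrite fset_setU1 // cardfsU1 in_fset_set // asboolT //; congr (_ + _)%N.
  apply/eqP; rewrite eqb1; apply/negP; rewrite inE => -[_ /mem_infix sub].
  case/negP: vp; apply: sub; rewrite /t0.
  by have := seg_gt1 s; case: (size s) => //= n _; rewrite mem_head.
have -> : [set t | translates s t /\ infix t (v :: p)] =
          [set t | translates s t /\ infix t p].
  apply/seteqP; split=> t; rewrite /mkset infix_consl => -[st].
    by move=> /orP[|//]; rewrite prefE // => /eqP tE; case: nst0; rewrite -tE.
  by move=> tp; split=> //; rewrite tp orbT.
by split=> //; rewrite asboolF.
Qed.

Lemma num_translates_occ s x y : num_translates s x y = occ s (geod x y).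
Proof. by have [] := card_translates s (geod_uniq x y). Qed.

Lemma occ_map s g p : occ s (map (a g) p) = occ s p.
Proof.
elim: p => //= v p ->; congr (nat_of_bool _ + _)%N; rewrite -map_cons -map_take.
apply/asbool_equiv_eq; split=> -[h E].
  exists (g^-1 * h)%g; apply: (inj_map (@act_inj g)); rewrite E -map_comp.
  by apply: eq_map => u /=; rewrite -actM mulVKg.
by exists (g * h)%g; rewrite E -map_comp; apply: eq_map => u /=; rewrite actM.
Qed.

Lemma f_seg_act s g x y : f_seg s (a g x) (a g y) = f_seg s x y.
Proof. by rewrite /f_seg !num_translates_occ !geod_act !occ_map. Qed.

Lemma occ_cat s p q :
  (occ s p + occ s q <= occ s (p ++ q) <= occ s p + occ s q + minn (size p) (size s))%N.
Proof.
elim: p => [|v p IH] /=; first by rewrite add0n min0n addn0 leqnn.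
have [vs|vs] := leqP (size s) (size (v :: p)).
  rewrite -cat_cons takel_cat //.
  case/andP: IH => IH1 IH2; rewrite -!addnA !leq_add2l addnA IH1 /=.
  by rewrite (leq_trans IH2) // leq_add2l geq_minr.
have -> : `[< translates s (take (size s) (v :: p)) >] = false.
  apply/asboolF => /translates_size; rewrite take_oversize; last exact: ltnW.
  by move=> E; rewrite E ltnn in vs.
case/andP: IH => IH1 IH2; rewrite add0n (leq_trans IH1) ?leq_addl //=.
by rewrite addnS -add1n leq_add ?leq_b1 // (leq_trans IH2) // leq_add2l geq_minl.
Qed.

Lemma num_translates_split s x y m : m \in geod x y ->
  (num_translates s x m + num_translates s m y <= num_translates s x y + size s
  /\ num_translates s x y <= num_translates s x m + num_translates s m y + size s)%N.
Proof.
move=> mxy; have [A [B E]] : exists A B, geod x y = A ++ m :: B.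
  by case/splitPr: mxy => A B; exists A, B.
rewrite !num_translates_occ; have [-> ->] := geod_split E; rewrite E -cats1.
have := occ_cat s A (m :: B); have := occ_cat s A [:: m]; have := seg_gt1 s.
rewrite [occ s [:: m]]/=.
have -> : `[< translates s (take (size s) [:: m]) >] = false.
  apply/asboolF => /translates_size; rewrite size_take /=.
  by have := seg_gt1 s; case: (size s) => [|[|n]].
have := geq_minr (size A) (size s); move: (minn _ _) => k.
by rewrite add0n addn0; move: (size s) (occ s _) (occ s _) (occ s _) (occ s _) => l b c d e; lia.
Qed.

Lemma f_seg_split s x y m : m \in geod x y ->
  `|f_seg s x m + f_seg s m y - f_seg s x y| <= (2 * size s)%:R.
Proof.
move=> mxy; have [h1 h2] := num_translates_split s mxy.
rewrite -geod_sym_mem in mxy; have [h3 h4] := num_translates_split s mxy.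
rewrite /f_seg; move: h1 h2 h3 h4; rewrite -!(ler_nat R) !natrD ler_norml.
lra.
Qed.

Lemma f_seg_quasi s x y z :
  `|f_seg s x y + f_seg s y z - f_seg s x z| <= (6 * size s)%:R.
Proof.
have [m [mxy myz mxz]] := geod_median x y z.
have := f_seg_split s mxy; have := f_seg_split s myz; have := f_seg_split s mxz.
rewrite /f_seg !ler_norml !natrM; lra.
Qed.

Lemma median_subproof s x : exists D : R, forall g h,
  `|f_seg s x (a g x) + f_seg s x (a h x) - f_seg s x (a (g * h)%g x)| <= D.
Proof.
exists (6 * size s)%:R => g h; rewrite -(f_seg_act s g x (a h x)) -actM.
exact: f_seg_quasi.
Qed.

Definition median_quasimorphism s x : quasimorphism R G :=
  @Quasimorphism R G (fun g => f_seg s x (a g x)) (median_subproof s x).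

End MedianQuasimorphism.

(* Main.v *)
(** Let [v] be the first vertex of [s], and let [mu] be an invariant mean on its
    stabilizer. Averaging a bounded cocycle [z] over [mu] in its first variable
    turns that variable into a vertex [u] of the orbit of [v], so one may sum
    [z(u, c_1, ..., c_n)] over the first vertices [u] of the translates of [s] in
    [[c_0 x, c_1 x]], minus the same over [[c_1 x, c_0 x]]. This is an invariant
    (unbounded) cochain [eta]. By the cocycle relation in the remaining variables,
    [hat f \cup z + delta eta] is the defect of additivity, along the triangle
    [c_0 x, c_1 x, c_2 x], of the count of translates weighted by
    [z(u, c_2, ..., c_(n+1))], hence it is bounded; its coboundary is
    [delta (hat f) \cup z]. *)

Require Import Defs.
From mathcomp Require Import all_boot all_order all_algebra.
From mathcomp Require Import all_classical all_reals.
From mathcomp Require Import lra.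

Set Implicit Arguments.
Unset Strict Implicit.
Unset Printing Implicit Defensive.

Import Order.TTheory GRing.Theory Num.Theory.
Local Open Scope ring_scope.

(** * Invariant means on bounded functions *)

Section InvariantMean.
Variables (R : realType) (H : groupType).

Definition invariant_mean (mu : (H -> R) -> R) : Prop :=
  [/\ forall (a : R) (f g : H -> R), linf f -> linf g ->
        mu (fun x => a * f x + g x) = a * mu f + mu g,
      forall f : H -> R, linf f -> (forall x, 0 <= f x) -> 0 <= mu f,
      mu (fun _ => 1) = 1
    & forall (f : H -> R) (h : H), linf f -> mu (fun x => f (h * x)%g) = mu f].

Variable mu : (H -> R) -> R.

Lemma mean_cst c : invariant_mean mu -> mu (fun _ => c) = c.
Proof.
move=> [muL _ mu1 _].
have mu0 : mu (fun _ => 0) = 0.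
  have := muL 1 (fun _ => 0) (fun _ => 0) (linf_cst _ _) (linf_cst _ _).
  by under eq_fun do rewrite mulr0 addr0; rewrite mul1r => /eqP; rewrite -subr_eq subrr => /eqP.
have := muL c (fun _ => 1) (fun _ => 0) (linf_cst _ _) (linf_cst _ _).
by under eq_fun do rewrite mulr1 addr0; rewrite mu0 mu1 mulr1 addr0.
Qed.

(** Positivity of the mean, applied to [M + f] and [M - f]. *)
Lemma mean_norm_le f M : invariant_mean mu ->
  (forall h, `|f h| <= M) -> `|mu f| <= M.
Proof.
move=> muP fM; have [muL mu_ge0 _ _] := muP.
have fb : linf f by exists M.
have fE c : mu (fun h => c * f h + M) = c * mu f + M.
  by rewrite muL ?mean_cst //; exact: linf_cst.
have ge0 c : `|c| = 1 -> 0 <= c * mu f + M.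
  move=> c1; rewrite -fE; apply: mu_ge0 => [|h].
    by apply: linfD; [apply: linfM => //|]; exact: linf_cst.
  have : `|c * f h| <= M by rewrite normrM c1 mul1r.
  by rewrite ler_norml; lra.
have := ge0 1 (normr1 _); have := ge0 (-1) (normrN1 _).
by rewrite ler_norml; lra.
Qed.

Lemma mean_sum (I : Type) (r : seq I) (a : I -> R) (f : I -> H -> R) :
  invariant_mean mu -> (forall i, linf (f i)) ->
  mu (fun h => \sum_(i <- r) a i * f i h) = \sum_(i <- r) a i * mu (f i).
Proof.
move=> muP fb; have [muL _ _ _] := muP; elim: r => [|i r IH].
  by under eq_fun do rewrite big_nil; rewrite big_nil mean_cst.
under eq_fun do rewrite big_cons.
rewrite big_cons muL ?IH //.
by apply: linf_sum => j; apply: linfM => //; exact: linf_cst.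
Qed.

End InvariantMean.

(** * Weighted counts of translates along geodesics *)

Section WeightedCount.
Variables (R : realType) (G : groupType) (T : tree) (a : tree_action G T).
Variable s : segment T.
Implicit Types (w : T -> R) (p q : seq T) (x y z : T).

Fixpoint wocc w p : R :=
  if p is u :: p' then
    (if `[< translates a s (take (size s) p) >] then w u else 0) + wocc w p'
  else 0.

Definition wcount w x y : R := wocc w (geod x y) - wocc w (geod y x).

Lemma wocc_cst (c : R) p : wocc (fun _ => c) p = (occ a s p)%:R * c.
Proof.
elim: p => [|u p IH]; first by rewrite mul0r.
rewrite [LHS]/= IH [occ _ _ _]/= natrD mulrDl.
by case: ifP => _; rewrite ?mul1r ?mul0r.
Qed.

(** Moves the second factor of the cup product inside the count, where it can be expanded separately
    at each vertex. *)
Lemma f_segM (c : R) x y : f_seg R a s x y * c = wcount (fun _ => c) x y.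
Proof. by rewrite /f_seg !num_translates_occ /wcount !wocc_cst mulrBl. Qed.

Lemma wocc_sum (I : Type) (r : seq I) (b : I -> R) (w : I -> T -> R) p :
  wocc (fun u => \sum_(i <- r) b i * w i u) p = \sum_(i <- r) b i * wocc (w i) p.
Proof.
elim: p => [|u p IH] /=; first by rewrite big1 // => i _; rewrite mulr0.
under [RHS]eq_bigr do rewrite mulrDr.
rewrite big_split IH; congr (_ + _).
by case: ifP => // _; rewrite big1 // => i _; rewrite mulr0.
Qed.

Lemma wcount_sum (I : Type) (r : seq I) (b : I -> R) (w : I -> T -> R) x y :
  wcount (fun u => \sum_(i <- r) b i * w i u) x y = \sum_(i <- r) b i * wcount (w i) x y.
Proof.
rewrite /wcount !wocc_sum -sumrB; apply: eq_bigr => i _.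
by rewrite mulrBr.
Qed.

Variable v : T.
Hypothesis headE : head v s = v.

(** Weights are read only at first vertices of translates of [s], so comparing them on the orbit of
    [v] suffices. *)
Lemma wocc_act w w' g p : (forall h, w (a (g * h)%g v) = w' (a h v)) ->
  wocc w (map (a g) p) = wocc w' p.
Proof.
move=> ww'; elim: p => //= u p ->; congr (_ + _).
rewrite -map_cons -map_take.
have -> : `[< translates a s (map (a g) (take (size s) (u :: p))) >] =
          `[< translates a s (take (size s) (u :: p)) >].
  (* Cancelling the counts of the tails in [occ_map] isolates one indicator. *)
  have := occ_map a s g (u :: p); rewrite /= occ_map -map_cons -map_take.
  by move/addIn; do 2!case: `[< _ >].
case: ifP => // /asboolP[h]; have := seg_gt1 s; move: headE.
case: (seg s) => [//|v' s'] /= -> _ [-> _].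
by rewrite -actM.
Qed.

Lemma wcount_act w w' g x y : (forall h, w (a (g * h)%g v) = w' (a h v)) ->
  wcount w (a g x) (a g y) = wcount w' x y.
Proof. by move=> ww'; rewrite /wcount !geod_act !(wocc_act _ ww'). Qed.

Variables (w : T -> R) (M : R).
Hypothesis wM : forall u, `|w u| <= M.

(** The error comes from translates straddling the junction: they start in [p], fewer than [size s]
    vertices before its end. *)
Lemma wocc_cat p q :
  `|wocc w (p ++ q) - wocc w p - wocc w q| <= M *+ minn (size p) (size s).
Proof.
elim: p => [|u p IH] /=; first by rewrite min0n subr0 subrr normr0.
have M0 : 0 <= M := le_trans (normr_ge0 _) (wM u).
have [us|us] := leqP (size s) (size (u :: p)).
  rewrite -cat_cons takel_cat // opprD addrACA subrr add0r.
  by apply: le_trans IH _; rewrite ler_wpMn2l // geq_minr.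
have -> : `[< translates a s (take (size s) (u :: p)) >] = false.
  apply/asboolF => /translates_size; rewrite take_oversize; last exact: ltnW.
  by move=> E; rewrite E ltnn in us.
rewrite add0r [size (u :: p)]/= mulrS -!addrA.
apply: le_trans (ler_normD _ _) _; apply: lerD; first by case: ifP; rewrite ?normr0.
rewrite addrA; apply: le_trans IH _.
by rewrite ler_wpMn2l // geq_minl.
Qed.

Lemma wocc_split x y m : m \in geod x y ->
  `|wocc w (geod x m) + wocc w (geod m y) - wocc w (geod x y)| <= M *+ (2 * size s).
Proof.
have M0 : 0 <= M := le_trans (normr_ge0 _) (wM x).
move=> mxy; have [A [B E]] : exists A B, geod x y = A ++ m :: B.
  by case/splitPr: mxy => A B; exists A, B.
have [-> ->] := geod_split E; rewrite E -cats1.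
have m0 : wocc w [:: m] = 0.
  rewrite /= asboolF ?addr0 // => /translates_size; rewrite size_take /=.
  by have := seg_gt1 s; case: (size s) => [|[|n]].
have le p q := le_trans (wocc_cat p q) (ler_wpMn2l M0 (geq_minr (size p) (size s))).
(* Both [[x, y]] and [[x, m]] are cut after [A], which gives the factor 2. *)
have := le A (m :: B); have := le A [:: m].
by rewrite m0 subr0 mulrnA mulr2n mulrnDl !ler_norml; lra.
Qed.

(** Cutting the three sides at the median, in both orientations, costs six errors
    [M *+ (2 * size s)]; the remaining counts cancel. *)
Lemma wcount_quasi x y z :
  `|wcount w x y + wcount w y z - wcount w x z| <= M *+ (12 * size s).
Proof.
have [m [mxy myz mxz]] := geod_median x y z.
have := wocc_split mxy; have := wocc_split myz; have := wocc_split mxz.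
rewrite -geod_sym_mem in mxy; rewrite -geod_sym_mem in myz; rewrite -geod_sym_mem in mxz.
have := wocc_split mxy; have := wocc_split myz; have := wocc_split mxz.
have -> : M *+ (12 * size s) = 6 * (M *+ (2 * size s)).
  by rewrite mulr_natl -mulrnA mulnAC.
by rewrite /wcount !ler_norml; lra.
Qed.

End WeightedCount.

(** * Averaging a cocycle over a vertex stabilizer *)

Section Smearing.
Variables (R : realType) (G : groupType) (T : tree) (a : tree_action G T).
Variables (v : T) (mu : (stabilizer a v -> R) -> R).
Hypothesis muP : invariant_mean mu.
Implicit Types (c : nat -> G) (u : T) (k : G).

Definition shift_cons k c : nat -> G := fun i => if i is j.+1 then c j else k.

(* Only meaningful on the orbit of [v]: it is [1] elsewhere. *)
Definition transporter u : G := xget 1%g [set k | a k v = u]%classic.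

Lemma transporterP k : a (transporter (a k v)) v = a k v.
Proof. by rewrite /transporter; case: xgetP => [y _ //|/(_ k) []]. Qed.

Definition smear n (z : cochain R G n) c u : R :=
  mu (fun h => eval z (shift_cons (transporter u * val h)%g c)).

Lemma smear_linf n (z : bcochain R G n) (k : stabilizer a v -> G) c :
  linf (fun h => eval z (shift_cons (k h) c)).
Proof.
by have /bounded_invariantP[[M zM] _] := valP z; exists M => h; exact: zM.
Qed.

Lemma smear_ext n (z : cochain R G n.+1) c c' u :
  (forall i, (i <= n)%N -> c i = c' i) -> smear z c u = smear z c' u.
Proof.
move=> cc'; congr mu; apply/funext => h; apply: eval_ext => -[|i] //=.
exact: cc'.
Qed.

(** With [t] and [t'] as below, [k * t] and [t'] both send [v] to the same vertex, hence differ by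
    an element of the stabilizer, which left invariance of [mu] absorbs. *)
Lemma smear_act n (z : bcochain R G n) c k g :
  smear z (fun i => k * c i)%g (a (k * g)%g v) = smear z c (a g v).
Proof.
have [_ _ _ muI] := muP.
set t := transporter (a g v); set t' := transporter (a (k * g)%g v).
have h0P : (t^-1 * k^-1 * t')%g \in stab a v.
  rewrite -topredE /= /stab !actM transporterP -!actM -!mulgA mulKg.
  by rewrite actM -transporterP -/t -actM mulVg act1.
rewrite -[RHS](muI _ (exist (fun h => h \in stab a v) _ h0P)); last first.
  exact: (smear_linf z (fun h => t * val h)%g c).
congr mu; apply/funext => h; have /bounded_invariantP[_ zi] := valP z.
rewrite -[RHS](zi k) -[RHS]/(eval z (fun i => k * shift_cons _ c i)%g).
apply: eval_ext => -[|i] //= _.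
by rewrite -/t' -/t !mulgA mulgK mulgV mul1g.
Qed.

(** The cocycle relation with [transporter u * h] put in front of [c], averaged over [h]: the term
    omitting this entry is constant in [h]. *)
Lemma smear_cocycle n (z : cocycle R G n.+1) c u :
  eval z c = \sum_(j < n.+2) (-1) ^+ j * smear z (c \o bump j) u.
Proof.
rewrite -mean_sum //; last by move=> j; exact: smear_linf.
rewrite -[LHS](mean_cst _ muP); congr mu; apply/funext => h.
have := eval_cocycle z (shift_cons (transporter u * val h)%g c).
rewrite eval_delta big_ord_recl expr0 mul1r => /eqP; rewrite addr_eq0 => /eqP.
move=> E; rewrite -[LHS]/(eval z (shift_cons (transporter u * val h)%g c \o bump 0)) E.
rewrite -sumrN; apply: eq_bigr => j _.
rewrite exprS mulN1r mulNr opprK; congr (_ * _).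
by apply: eval_ext => -[|i] _ //=; rewrite -[bump 0 j]/(j.+1) bumpS.
Qed.

End Smearing.

(** * The bounded invariant primitive *)

Section Primitive.
Variables (R : realType) (G : groupType) (T : tree) (a : tree_action G T).
Variables (s : segment T) (x v : T) (mu : (stabilizer a v -> R) -> R).
Hypotheses (headE : head v s = v) (muP : invariant_mean mu).
Variables (n : nat) (z : cocycle R G n.+1).

(* [inord] turns a tuple into a sequence, whose terms of index [> n.+1] are junk. *)
Definition eta : cochain R G n.+1 := fun c =>
  wcount a s (smear mu z (fun i => c (inord i.+1))) (a (c (inord 0)) x) (a (c (inord 1)) x).

Lemma eval_eta (c : nat -> G) :
  eval eta c = wcount a s (smear mu z (c \o S)) (a (c 0%N) x) (a (c 1%N) x).
Proof.
rewrite /eval /eta !inordK //; congr wcount; apply/funext => u.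
by apply: smear_ext => i ni; rewrite /= inordK.
Qed.

Definition primitive : cochain R G n.+2 :=
  cup (hat (median_quasimorphism R a s x)) z + delta eta.

Lemma eval_primitive (c : nat -> G) (w := smear mu z (fun i => c i.+2)) :
  eval primitive c = wcount a s w (a (c 0%N) x) (a (c 1%N) x)
                   + wcount a s w (a (c 1%N) x) (a (c 2%N) x)
                   - wcount a s w (a (c 0%N) x) (a (c 2%N) x).
Proof.
rewrite -[LHS]/(eval (cup (hat (median_quasimorphism R a s x)) z) c + eval (delta eta) c).
rewrite eval_cup.
have -> : eval (hat (median_quasimorphism R a s x)) c = f_seg R a s (a (c 0%N) x) (a (c 1%N) x).
  by rewrite -(f_seg_act R a s (c 0%N)^-1%g) -!actM mulVg act1.
rewrite f_segM.
have -> : (fun _ : T => eval z (fun i => c (1 + i)%N)) =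
    fun u => \sum_(j < n.+2) (-1) ^+ j * smear mu z (c \o S \o bump j) u.
  by apply/funext => u; exact: smear_cocycle.
(* In [delta eta], omitting entry 0 or 1 changes the endpoints of the count. Omitting a later entry
   changes only the weight, and these terms [S2] cancel the tail [S1] of the expansion of [z]. *)
rewrite wcount_sum eval_delta big_ord_recl [X in _ + X = _]big_ord_recl.
rewrite [X in _ + (_ + X) = _]big_ord_recl !eval_eta !expr0 !mul1r expr1 mulN1r.
set S1 := \sum_(_ < _) _; set S2 := \sum_(_ < _) _.
have -> : S2 = - S1.
  rewrite /S1 /S2 -sumrN; apply: eq_bigr => j _; rewrite eval_eta exprS mulN1r mulNr.
  congr (- (_ * wcount _ _ _ _ _)); apply/funext => u; apply: smear_ext => i _ /=.
  by rewrite -[bump 0 (bump 0 j)]/(j.+2) bumpS.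
rewrite -[LHS]/(wcount a s w (a (c 0%N) x) (a (c 1%N) x) + S1
  + (wcount a s w (a (c 1%N) x) (a (c 2%N) x)
  + (- wcount a s w (a (c 0%N) x) (a (c 2%N) x) - S1))).
by lra.
Qed.

Lemma primitive_bounded_invariant : primitive \in @bounded_invariant R G n.+2.
Proof.
have evE (c : 'I_n.+3 -> G) : primitive c = eval primitive (fun i => c (inord i)).
  by congr primitive; apply/funext => i; rewrite inord_val.
have /bounded_invariantP[[M zM] _] := valP (z : bcochain R G n.+1).
apply/bounded_invariantP; split=> [|g c].
  exists (M *+ (12 * size s)) => c; rewrite evE eval_primitive.
  apply: wcount_quasi => u; apply: (mean_norm_le muP) => h; exact: zM.
rewrite !evE !eval_primitive !actM.
by congr (_ + _ - _); apply: (wcount_act headE) => h; exact: smear_act.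
Qed.

(** [deltaK] holds for all cochains, so it applies to the unbounded [eta]; the other Leibniz term
    vanishes because [z] is a cocycle. *)
Lemma delta_primitive :
  delta primitive = cup (delta (hat (median_quasimorphism R a s x))) z.
Proof.
apply: cochain_eqP => c.
have -> : eval (delta primitive) c =
    eval (delta (cup (hat (median_quasimorphism R a s x)) z)) c + eval (delta (delta eta)) c.
  by rewrite !eval_delta -[RHS]big_split; apply: eq_bigr => j _ /=; rewrite -mulrDr.
by rewrite deltaK leibniz eval_cocycle !mulr0 addr0; exact: addr0.
Qed.

End Primitive.

Theorem corollary1p5 (R : realType) (G : groupType) (T : tree)
    (a : tree_action G T)
    (stab_amenable : forall v : T, amenable R (stabilizer a v))
    (s : segment T) (x : T) (n : nat) (n_ge1 : (1 <= n)%N) (zeta : Hb R G n) :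
  Hb_cup (qm_class (median_quasimorphism R a s x)) zeta = 0 :> Hb R G (2 + n).
Proof.
(* In positive degree [eta], of the same degree as [zeta], has the two variables that bound its
   geodesic. *)
case: n n_ge1 zeta => [//|n] _ zeta.
(* Here [x] is only a default value, as [s] is nonempty. *)
have [mu muP] := stab_amenable (head x s).
have headE : head (head x s) s = head x s by case: (seg s).
rewrite -[zeta]reprK -[_ _ (repr zeta)]/(Hb_class (repr zeta)) Hb_cup_class.
apply/eqP; rewrite Hb_class_eq0; apply/asboolP.
exists (BCochain (primitive_bounded_invariant x headE muP (repr zeta))).
by apply/val_inj; rewrite /= delta_primitive.
Qed.
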